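(* Let $k\ge2$. The poset $(\mathcal C_k,\preceq)$ is a finite join-semilattice with the maximum graph $\overline K_{[k]}\circ\Gamma_k$.
   Context: All graphs are finite and simple. $[k]=\{1,\dots,k\}$; $[3]^k$ is the set of vectors $x=(x_{(1)},\dots,x_{(k)})$ with entries in $\{1,2,3\}$. For a graph $F$ and $S\subseteq V(F)$, $\mathcal E(F,S)$ is the set of all $S$-coverings in $F$, i.e. sets $E\subseteq E(F)$ such that every vertex of $S$ is incident to at least one edge of $E$. $\overline K_{[k]}$ is the edgeless graph on $[k]$. For a graph $H_2$ on $[3]^k$, $\overline K_{[k]}\circ H_2$ is the graph on the disjoint union $[k]\sqcup[3]^k$ with edge set $E(H_2)\cup\{\{i,x\}: i\in[k],\ x\in[3]^k,\ x_{(i)}=1\}$. For a set $E$ of 2-subsets of $[3]^k$, $span(E)$ is the graph with vertex set $[3]^k$ and edge set $E$. For $i\in[k]$ and $j\in\{1,2,3\}$ let $[3]^k_i(j)=\{x\in[3]^k:x_{(i)}=j\}$. Let $C^k_i$ be the bipartite graph with parts $[3]^k_i(1)$ and $[3]^k_i(2)$, in which $x\in[3]^k_i(1)$ and $y\in[3]^k_i(2)$ are adjacent iff $|x_{(t)}-y_{(t)}|\le1$ for all $t\in[k]\setminus\{i\}$; let $D^k_i$ be the bipartite graph with parts $[3]^k_i(2)$ and $[3]^k_i(3)$, in which $x\in[3]^k_i(2)$ and $y\in[3]^k_i(3)$ are adjacent iff $|x_{(t)}-y_{(t)}|\le1$ for all $t\in[k]\setminus\{i\}$. Let $S^k_i=\{x\in[3]^k: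 x_{(i)}=3,\ x_{(t)}\in\{2,3\}\ \forall t\in[k]\}$. Define $$\mathcal C_k=\Big\{\overline K_{[k]}\circ span\Big(\bigcup_{i\in[k]}(E_i\cup F_i)\Big): E_i\in\mathcal E(C^k_i,[3]^k_i(2)),\ F_i\in\mathcal E(D^k_i,S^k_i)\ \text{for each } i\in[k]\Big\}.$$ $\Gamma_k$ is the graph with vertex set $[3]^k$ in which distinct $x,y$ are adjacent iff $|x_{(i)}-y_{(i)}|\le1$ for each $i\in[k]$. For graphs $G_1,G_2$ with the same vertex set, $G_1\preceq G_2$ means $G_1$ is a spanning subgraph of $G_2$, i.e. $E(G_1)\subseteq E(G_2)$. A join-semilattice is a poset in which any pair of elements has a least upper bound. A maximum element is an element $x$ with $a\preceq x$ for all $a$. *)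

(* Defs.v *)
From mathcomp Require Import all_boot ssrint.
From mathcomp Require Import classical_sets cardinality.

Set Implicit Arguments.
Unset Strict Implicit.
Unset Printing Implicit Defensive.

Local Open Scope nat_scope.

(** * Finite simple graphs with vertices in a finite type *)

Definition graph_wf (T : finType) (V : {set T}) (E : {set {set T}}) : bool :=
  [forall e in E, (e \subset V) && (#|e| == 2)].

Record graph (T : finType) : Type := Graph {
  verts : {set T};
  edges : {set {set T}};
  graphP : graph_wf verts edges
}.

Lemma mkgraph_subproof (T : finType) (V : {set T}) (E : {set {set T}}) :
  graph_wf V [set e in E | (e \subset V) && (#|e| == 2)]%SET.
Proof. by apply/forall_inP => e; rewrite inE => /andP[]. Qed.

(* Elements of E that are not 2-subsets of V are dropped; by mkgraph_edges this
   never happens when E is a legitimate edge set, as in all the uses below. *)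
Definition mkgraph (T : finType) (V : {set T}) (E : {set {set T}}) : graph T :=
  Graph (mkgraph_subproof V E).

Lemma mkgraph_edges (T : finType) (V : {set T}) (E : {set {set T}}) :
  graph_wf V E -> edges (mkgraph V E) = E.
Proof.
move=> /forall_inP wfE; apply/setP => e; rewrite inE.
by case: (boolP (e \in E)) => // /wfE.
Qed.

Definition spanning_subgraph (T : finType) (G1 G2 : graph T) : Prop :=
  verts G1 = verts G2 /\ edges G1 \subset edges G2.

Definition coverings (T : finType) (F : graph T) (S : {set T}) :
    {set {set {set T}}} :=
  [set E : {set {set T}} |
     (E \subset edges F) && [forall v in S, [exists e in E, v \in e]]]%SET.

Definition bipartite (T : finType) (A B : {set T}) (r : rel T) : graph T :=
  mkgraph (A :|: B) [set [set x; y] | x in A, y in B & r x y]%SET.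

(** * The cube [3]^k *)

Definition cube (k : nat) : finType := {ffun 'I_k -> 'I_3}.

(* Elements of 'I_3 are 0, 1, 2; the shift gives coordinates in {1, 2, 3}. *)
Definition coord (k : nat) (x : cube k) (i : 'I_k) : nat := (x i).+1.

Definition close (k : nat) (x y : cube k) (t : 'I_k) : bool :=
  `|coord x t - coord y t| <= 1.

Definition layer (k : nat) (i : 'I_k) (j : nat) : {set cube k} :=
  [set x : cube k | coord x i == j]%SET.

Definition close_off (k : nat) (i : 'I_k) : rel (cube k) :=
  fun x y => [forall (t | t != i), close x y t].

Definition Cgraph (k : nat) (i : 'I_k) : graph (cube k) :=
  bipartite (layer i 1) (layer i 2) (close_off i).

Definition Dgraph (k : nat) (i : 'I_k) : graph (cube k) :=
  bipartite (layer i 2) (layer i 3) (close_off i).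

Definition Sset (k : nat) (i : 'I_k) : {set cube k} :=
  [set x : cube k | (coord x i == 3) &&
     [forall t, (coord x t == 2) || (coord x t == 3)]]%SET.

Definition span (k : nat) (E : {set {set cube k}}) : graph (cube k) :=
  mkgraph [set: cube k]%SET E.

Definition Gamma (k : nat) : graph (cube k) :=
  mkgraph [set: cube k]%SET
    [set [set x; y] | x in [set: cube k], y in [set: cube k]
                    & (x != y) && [forall i, close x y i]]%SET.

Definition vertex (k : nat) : finType := ('I_k + cube k)%type.

(* The composition of the edgeless graph on [k] with H, whose vertex set is
   understood to be all of [3]^k. *)
Definition circ (k : nat) (H : graph (cube k)) : graph (vertex k) :=
  mkgraph [set: vertex k]%SET
    ([set inr @: (e : {set cube k}) | e in edges H]
     :|: [set [set inl i; inr x] | i in [set: 'I_k], x in [set: cube k]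
                                 & coord x i == 1])%SET.

Definition calC (k : nat) : set (graph (vertex k)) :=
  fun G => exists E F : 'I_k -> {set {set cube k}},
    [/\ forall i, E i \in coverings (Cgraph i) (layer i 2),
        forall i, F i \in coverings (Dgraph i) (Sset i)
      & G = circ (span (\bigcup_(i : 'I_k) (E i :|: F i))%SET)].
Arguments calC k : clear implicits.

(** * Order-theoretic notions for a relation restricted to a set *)

Definition poset_on (T : Type) (A : set T) (le : T -> T -> Prop) : Prop :=
  [/\ forall x, A x -> le x x,
      forall x y, A x -> A y -> le x y -> le y x -> x = y
    & forall x y z, A x -> A y -> A z -> le x y -> le y z -> le x z].

Definition lub_on (T : Type) (A : set T) (le : T -> T -> Prop) (x y z : T) :
    Prop :=
  [/\ A z, le x z, le y z
    & forall w, A w -> le x w -> le y w -> le z w].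

Definition join_semilattice_on (T : Type) (A : set T) (le : T -> T -> Prop) :
    Prop :=
  poset_on A le /\
  forall x y, A x -> A y -> exists z, lub_on A le x y z.

Definition maximum_on (T : Type) (A : set T) (le : T -> T -> Prop) (m : T) :
    Prop :=
  A m /\ forall a, A a -> le a m.

(* Main.v *)
(* Two vectors joined by an edge of [Gamma_k] differ by exactly one in some
   coordinate [i], so the edge lies in [C_i] or in [D_i]: the union of all these
   graphs is [Gamma_k].  Edge sets of [C_i] and [D_i] containing a covering are
   coverings, so [calC k] is closed under unions of edge sets, which are the
   joins, and taking every covering full yields the maximum. *)
Require Import Defs.
From mathcomp Require Import all_boot ssrint.
From mathcomp Require Import classical_sets cardinality.
From mathcomp Require Import finset.

Set Implicit Arguments.
Unset Strict Implicit.
Unset Printing Implicit Defensive.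

Lemma graph_eq (T : finType) (G H : graph T) :
  verts G = verts H -> edges G = edges H -> G = H.
Proof.
case: G H => [V E p] [V' E' p'] /= eqV eqE; subst V' E'.
by rewrite (bool_irrelevance p p').
Qed.

(** Such a family lies in the image of the finite type of edge sets [U] under [circ (span U)], so
    the record type [graph] itself need not be enumerated. *)
Lemma finite_set_circ_span (k : nat) (A : set (graph (vertex k))) :
  (forall G, A G -> exists U, G = circ (span U)) -> finite_set A.
Proof.
move=> AP; apply: (@sub_finite_set _ _
    [set circ (span U) | U in [set: {set {set cube k}}]]%classic).
  by move=> G /AP[U ->]; exists U.
exact/finite_image/finite_finset.
Qed.

Lemma edges_circ_spanU (k : nat) (U W : {set {set cube k}}) :
  edges (circ (span (U :|: W))) =
    edges (circ (span U)) :|: edges (circ (span W)).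
Proof.
have spanU : edges (span (U :|: W)) = edges (span U) :|: edges (span W).
  by apply/setP => e; rewrite !inE andb_orl.
(* Each side on the right carries a copy of the fixed edges between ['I_k] and the cube;
   [orbACA orbb] merges the two copies. *)
by apply/setP => e; rewrite !in_set spanU imsetU in_setU -andb_orl orbACA orbb.
Qed.

Lemma edges_circ_spanS (k : nat) (U W : {set {set cube k}}) :
  U \subset W -> edges (circ (span U)) \subset edges (circ (span W)).
Proof. by move=> /setUidPr <-; rewrite edges_circ_spanU subsetUl. Qed.

Lemma coverings_full (T : finType) (F : graph T) (S : {set T}) :
  (forall v, v \in S -> exists2 e, e \in edges F & v \in e) ->
  edges F \in coverings F S.
Proof.
move=> covS; rewrite inE subxx; apply/forall_inP => v /covS[e eF ve].
by apply/exists_inP; exists e.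
Qed.

Lemma coveringsU (T : finType) (F : graph T) (S : {set T}) E E' :
  E \in coverings F S -> E' \in coverings F S -> E :|: E' \in coverings F S.
Proof.
rewrite !inE subUset => /andP[-> /forall_inP covE] /andP[-> _] /=.
apply/forall_inP => v /covE /exists_inP[e eE ve].
by apply/exists_inP; exists e; rewrite // inE eE.
Qed.

(** Disjointness of the parts forces [x != y], so every [[set x; y]] has two elements and [mkgraph]
    drops none of them. *)
Lemma edges_bipartiteP (T : finType) (A B : {set T}) (r : rel T) (e : {set T}) :
  [disjoint A & B] ->
  reflect (exists x y, [/\ x \in A, y \in B, r x y & e = [set x; y]])
          (e \in edges (bipartite A B r)).
Proof.
move=> disAB; rewrite mkgraph_edges; last first.
  apply/forall_inP => _ /imset2P[x y xA /[!inE] /andP[yB _] ->].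
  rewrite subUset !sub1set !inE xA yB orbT cards2; case: (x =P y) => // xy.
  by rewrite -xy in yB; rewrite (disjointFr disAB xA) in yB.
apply: (iffP imset2P) => [[x y xA /[!inE] /andP[yB rxy] ->]|].
  by exists x, y.
by move=> [x [y [xA yB rxy ->]]]; exists x y; rewrite // inE yB.
Qed.

Lemma disjoint_layer (k : nat) (i : 'I_k) (j j' : nat) :
  j != j' -> [disjoint layer i j & layer i j'].
Proof.
move=> neqj; apply/pred0P => x; rewrite /= !inE.
by apply/negP => /andP[/eqP -> /eqP jj']; rewrite jj' eqxx in neqj.
Qed.

(** Common form of both bipartite graphs: [j = 1] gives [Cgraph i] and [j = 2] gives [Dgraph i], by
    conversion. *)
Definition step_graph (k : nat) (i : 'I_k) (j : nat) : graph (cube k) :=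
  bipartite (layer i j) (layer i j.+1) (close_off i).

Lemma step_graphP (k : nat) (i : 'I_k) (j : nat) (e : {set cube k}) :
  reflect (exists x y, [/\ coord x i = j, coord y i = j.+1, close_off i x y
                         & e = [set x; y]])
          (e \in edges (step_graph i j)).
Proof.
have dis : [disjoint layer i j & layer i j.+1].
  by apply: disjoint_layer; rewrite neq_ltn ltnSn.
apply: (iffP (edges_bipartiteP _ _ dis)) => -[x [y [xj yj rxy ->]]];
  exists x, y; split=> //.
- by move: xj; rewrite inE => /eqP.
- by move: yj; rewrite inE => /eqP.
- by rewrite inE xj.
- by rewrite inE yj.
Qed.

(** Lowering the [i]-th coordinate of a vertex of the upper layer by one gives a neighbour in the
    lower layer. *)
Lemma step_graph_covering (k : nat) (i : 'I_k) (j : nat) (S : {set cube k}) :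
  0 < j -> S \subset layer i j.+1 ->
  edges (step_graph i j) \in coverings (step_graph i j) S.
Proof.
move=> j_gt0 /fintype.subsetP SL; apply: coverings_full => y /SL.
rewrite inE => /eqP yj.
(* Since [coord] shifts by one, the ordinal [j.-1] stands for the coordinate [j]. *)
pose x : cube k := [ffun t => if t == i then inord j.-1 else y t].
exists [set x; y]; last by rewrite !inE eqxx orbT.
apply/step_graphP; exists x, y; split=> //.
  rewrite /coord ffunE eqxx inordK prednK //.
  by move: yj (ltn_ord (y i)); rewrite /coord => -[->] /ltnW.
apply/forall_inP => t ti.
by rewrite /close /coord ffunE (negbTE ti) distnn.
Qed.

Lemma closeC (k : nat) (x y : cube k) (t : 'I_k) : close x y t = close y x t.
Proof. by rewrite /close distnC. Qed.

Lemma edges_GammaP (k : nat) (e : {set cube k}) :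
  reflect (exists x y, [/\ x != y, forall t, close x y t & e = [set x; y]])
          (e \in edges (Gamma k)).
Proof.
rewrite mkgraph_edges; last first.
  apply/forall_inP => _ /imset2P[x y _ /[!inE] /= /andP[xy _] ->].
  by rewrite subsetT cards2 xy.
apply: (iffP imset2P) => [[x y _ /[!inE] /= /andP[xy /forallP cl] ->]|].
  by exists x, y.
move=> [x [y [xy cl ->]]]; exists x y; rewrite ?inE //= xy.
exact/forallP.
Qed.

Lemma step_graph_Gamma (k : nat) (i : 'I_k) (j : nat) :
  edges (step_graph i j) \subset edges (Gamma k).
Proof.
apply/fintype.subsetP => _ /step_graphP[x [y [xj yj /forall_inP cl ->]]].
apply/edges_GammaP; exists x, y; split=> //.
  by apply: contra_eq_neq yj => <-; rewrite xj neq_ltn ltnSn.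
move=> t; have [->|/cl //] := eqVneq t i.
by rewrite /close xj yj distnEr ?subSnn.
Qed.

Lemma Gamma_step_graph (k : nat) (e : {set cube k}) :
  e \in edges (Gamma k) ->
  exists i, (e \in edges (step_graph i 1)) || (e \in edges (step_graph i 2)).
Proof.
(* The edge is oriented so that its [i]-th coordinate goes up by one from [x] to [y]. *)
have step (x y : cube k) i : (forall t, close x y t) ->
    coord y i = (coord x i).+1 ->
    ([set x; y] \in edges (step_graph i 1)) ||
    ([set x; y] \in edges (step_graph i 2)).
  move=> cl xyi.
  have step j : coord x i = j -> [set x; y] \in edges (step_graph i j).
    move=> xj; apply/step_graphP; exists x, y; split=> //.
      by rewrite xyi xj.
    by apply/forall_inP => t _; apply: cl.
  have : (coord x i == 1) || (coord x i == 2).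
    move: xyi (ltn_ord (y i)); rewrite /coord => -[->].
    (* The upper coordinate is at most 3, so the lower one is 1 or 2. *)
    by case: (nat_of_ord (x i)) => [|[|]].
  by case/orP => /eqP /step ->; rewrite ?orbT.
move=> /edges_GammaP[x [y [xy cl ->]]].
have [i xyi] : exists i, x i != y i.
  apply/existsP; apply: contraNT xy => /existsPn eqxy.
  by apply/eqP/ffunP => i; apply/eqP; move: (eqxy i); rewrite negbK.
exists i; have := cl i; rewrite /close.
(* Closeness turns a strict inequality into a difference of exactly one; when [x] is the higher end,
   the endpoints are swapped. *)
case: (ltngtP (coord x i) (coord y i)) => [lt|lt|[/val_inj eqi]]; last first.
- by rewrite eqi eqxx in xyi.
- rewrite distnEl ?(ltnW lt) // leq_subLR addn1 => le.
  rewrite setUC; apply: step => [t|]; first by rewrite closeC.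
  by apply/eqP; rewrite eqn_leq le.
- rewrite distnEr ?(ltnW lt) // leq_subLR addn1 => le.
  by apply: step => //; apply/eqP; rewrite eqn_leq le.
Qed.

Lemma edges_Gamma (k : nat) :
  edges (Gamma k) =
    \bigcup_(i : 'I_k) (edges (step_graph i 1) :|: edges (step_graph i 2)).
Proof.
apply/eqP; rewrite eqEsubset; apply/andP; split; last first.
  by apply/bigcupsP => i _; rewrite subUset !step_graph_Gamma.
apply/fintype.subsetP => e /Gamma_step_graph[i ei].
by apply/bigcupP; exists i; rewrite // inE.
Qed.

(** Puts [Gamma k] in the [span] form shared by the members of [calC k]. *)
Lemma Gamma_span (k : nat) : Gamma k = span (edges (Gamma k)).
Proof. by apply: graph_eq; rewrite // [RHS]mkgraph_edges //; apply: graphP. Qed.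

Lemma calC_circ_span (k : nat) (G : graph (vertex k)) :
  calC k G ->
  exists2 U : {set {set cube k}},
    U \subset edges (Gamma k) & G = circ (span U).
Proof.
move=> [E [F [covE covF ->]]]; eexists; last by [].
apply/bigcupsP => i _; move: (covE i) (covF i).
rewrite !inE subUset => /andP[Ei _] /andP[Fi _].
by rewrite (fintype.subset_trans Ei (step_graph_Gamma i 1))
           (fintype.subset_trans Fi (step_graph_Gamma i 2)).
Qed.

Lemma calC_Gamma (k : nat) : calC k (circ (Gamma k)).
Proof.
exists (fun i => edges (step_graph i 1)), (fun i => edges (step_graph i 2)).
split=> [i|i|]; last by rewrite -edges_Gamma -Gamma_span.
  exact: step_graph_covering.
(* It remains that [Sset i] lies in the layer of coordinate 3. *)
apply: step_graph_covering => //; apply/fintype.subsetP => x.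
by rewrite !inE => /andP[].
Qed.

Lemma calC_join (k : nat) (G H : graph (vertex k)) :
  calC k G -> calC k H ->
  exists2 J, calC k J & verts J = setT /\ edges J = edges G :|: edges H.
Proof.
move=> [E [F [covE covF ->]]] [E' [F' [covE' covF' ->]]].
(* Unification with [edges_circ_spanU] determines the join: [circ (span _)] of the union of both
   underlying edge sets. *)
eexists; last first.
  by split; [|exact: edges_circ_spanU]; reflexivity.
exists (fun i => E i :|: E' i), (fun i => F i :|: F' i); split=> [i|i|].
- exact: coveringsU.
- exact: coveringsU.
(* Regroups the union of the two families index by index, pairing [E i] with [E' i] and [F i] with
   [F' i]. *)
- by rewrite -big_split; under [in RHS]eq_bigr do rewrite setUACA.
Qed.

Theorem proposition4p17 (k : nat) (hk : (2 <= k)%N) :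
  [/\ finite_set (calC k),
      join_semilattice_on (calC k) (@spanning_subgraph (vertex k))
    & maximum_on (calC k) (@spanning_subgraph (vertex k))
        (circ (Gamma k))].
Proof.
split.
- by apply: finite_set_circ_span => G /calC_circ_span[U _ ->]; exists U.
- split=> [|G H CG CH]; first split.
  + by move=> G _; split.
  + move=> G H _ _ [eqV GH] [_ HG]; apply: graph_eq => //.
    by apply/eqP; rewrite eqEsubset GH.
  + move=> G H K _ _ _ [GH eGH] [HK eHK]; split; first by rewrite GH.
    exact: fintype.subset_trans eGH eHK.
  (* The edge set of [J] is exactly the union, hence contained in that of every upper bound. *)
  + have [J CJ [vJ eJ]] := calC_join CG CH.
    have vC K : calC k K -> verts K = setT by move=> /calC_circ_span[U _ ->].
    exists J; split=> //.
    * by split; rewrite ?vC // eJ subsetUl.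
    * by split; rewrite ?vC // eJ subsetUr.
    * move=> K CK [_ GK] [_ HK]; split; first by rewrite !vC.
      by rewrite eJ subUset GK.
- split=> [|G /calC_circ_span[U UG ->]]; first exact: calC_Gamma.
  by split=> //; rewrite Gamma_span; apply: edges_circ_spanS.
Qed.
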